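(* Let $G$ be a profinite group, let $i\ge1$, and let $A=\varprojlim_{n\in\mathbb{N}}A_n$ be a compact $G$-module presented as a countable inverse limit of finite discrete $G$-modules $A_n$. If $A_n$ is evenly continuous with respect to $G^{i-1}$ for all $n\in\mathbb{N}$, then $\varprojlim^1_{n\in\mathbb{N}}H^{i-1}(G,A_n)$ is trivial.
   Context: A $G$-module is a Hausdorff abelian topological group $A$ with a continuous left action $G\times A\to A$ by group automorphisms; the transition maps of the inverse system $(A_n)_{n\in\mathbb{N}}$ are continuous $G$-equivariant group homomorphisms. $H^{j}(G,A_n)$ is the usual continuous cochain cohomology of the profinite group $G$ with coefficients in the discrete module $A_n$ (with $H^0(G,A_n)=A_n^G$). For an inverse system $(X_n,\phi_n:X_{n+1}\to X_n)_{n\in\mathbb{N}}$ of abelian groups, $\varprojlim^1 X_n$ is the cokernel of $\prod_nX_n\to\prod_nX_n$, $(x_n)\mapsto(x_n-\phi_n(x_{n+1}))$. A set $F$ of maps $B\to A$ between topological spaces is evenly continuous if for each $b\in B$, each $a\in A$ and each neighbourhood $U$ of $a$ there exist a neighbourhood $V$ of $b$ and a neighbourhood $W$ of $a$ such that for all $f\in F$, $f(b)\in W$ implies $f(V)\subseteq U$. The space $A$ is evenly continuous with respect to $B$ if the set $M_{\mathrm{cts}}(B,A)$ of all continuous maps $B\to A$ is evenly continuous. $G^m$ carries the product topology, and $M_{\mathrm{cts}}(G^0,A)$ denotes the set of constant maps $G\to A$ (which is always evenly continuous). *)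

(* Defs.v *)
From HB Require Import structures.
From mathcomp Require Import all_boot all_order all_algebra.
From mathcomp Require Import all_classical all_reals all_analysis.

Set Implicit Arguments.
Unset Strict Implicit.
Unset Printing Implicit Defensive.

Import GRing.Theory.
Local Open Scope classical_set_scope.
Local Open Scope ring_scope.
Local Open Scope quotient_scope.

(** * Profinite groups *)

HB.mixin Record isTopologicalGroup G & Topological G & Group G := {
  mulg_continuous : continuous (fun x : G * G => (x.1 * x.2)%g) ;
  invg_continuous : continuous (fun x : G => x^-1%g) }.

#[short(type="topologicalGroupType")]
HB.structure Definition TopologicalGroup :=
  {G of Topological G & Group G & isTopologicalGroup G}.

Definition profinite (G : topologicalGroupType) :=
  [/\ compact [set: G], hausdorff_space G & totally_disconnected [set: G]].

(** * G-modules *)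

HB.mixin Record isGModule (G : topologicalGroupType) A
    & TopologicalZmodule A := {
  gact : G -> A -> A ;
  gact1 : forall a, gact 1%g a = a ;
  gactM : forall g h a, gact (g * h)%g a = gact g (gact h a) ;
  gactD : forall g, {morph gact g : a b / a + b} ;
  gact_continuous : continuous (fun x : G * A => gact x.1 x.2) ;
  gmod_hausdorff : hausdorff_space A }.

#[short(type="gmodType")]
HB.structure Definition GModule (G : topologicalGroupType) :=
  {A of TopologicalZmodule A & isGModule G A}.

Record gmodHom (G : topologicalGroupType) (A B : gmodType G) := GModHom {
  gmodHom_fun :> {additive A -> B} ;
  gmodHom_act : forall (g : G) a, gmodHom_fun (gact g a) = gact g (gmodHom_fun a) ;
  gmodHom_continuous : continuous gmodHom_fun }.

Definition finite_discrete (A : topologicalType) :=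
  finite_set [set: A] /\ forall U : set A, open U.

(* [p] exhibits [A] as the inverse limit: it identifies [A], as a topological
   space, with the subspace of compatible families in the product. *)
Definition is_inverse_limit (G : topologicalGroupType) (A : gmodType G)
    (A_ : nat -> gmodType G) (phi : forall n, gmodHom (A_ n.+1) (A_ n))
    (p : forall n, gmodHom A (A_ n)) :=
  let f : A -> prod_topology A_ := fun a n => p n a in
  [/\ injective f,
      range f = [set x | forall n, phi n (x n.+1) = x n]
    & forall U : set A, open U <->
        exists2 V : set (prod_topology A_), open V & U = f @^-1` V].

(** * Even continuity *)

Definition evenly_continuous (B A : topologicalType) (F : set (B -> A)) :=
  forall (b : B) (a : A) (U : set A), nbhs a U ->
    exists V : set B, exists W : set A,
      [/\ nbhs b V, nbhs a W & forall f, F f -> W (f b) -> f @` V `<=` U].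

Definition evenly_continuous_wrt (A B : topologicalType) :=
  evenly_continuous [set f : B -> A | continuous f].

Notation gpow G m := (prod_topology (fun _ : 'I_m => G)).

(* By convention $M_{cts}(G^0, A)$ is the set of constant maps $G \to A$. *)
Definition evenly_continuous_wrt_pow (A G : topologicalType) (m : nat) :=
  if m is 0 then evenly_continuous [set f : G -> A | exists a, f = cst a]
  else evenly_continuous_wrt A (gpow G m).

(** * Continuous cochain cohomology *)

Section Cohomology.
Context {G : topologicalGroupType}.

(* (g_0, ..., g_k g_(k+1), ..., g_j); [lift ord_max l] and [lift ord0 l] are the
   indices l and l+1. *)
Definition gpow_merge (j : nat) (k : 'I_j) (g : gpow G j.+1) : gpow G j :=
  fun l => if (l < k)%N then g (lift ord_max l)
           else if l == k then (g (lift ord_max l) * g (lift ord0 l))%g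
           else g (lift ord0 l).

(* Inhomogeneous coboundary:
     (df)(g_0, ..., g_j) = g_0 f(g_1, ..., g_j)
       + \sum_(k < j) (-1)^(k+1) f(g_0, ..., g_k g_(k+1), ..., g_j)
       + (-1)^(j+1) f(g_0, ..., g_(j-1)). *)
Definition coboundary (A : gmodType G) (j : nat) (f : gpow G j -> A) :
    gpow G j.+1 -> A :=
  fun g => gact (g ord0) (f (fun l => g (lift ord0 l)))
         + \sum_(k < j) f (gpow_merge k g) *~ (-1) ^+ k.+1
         + f (fun l => g (lift ord_max l)) *~ (-1) ^+ j.+1.

Lemma gactB (A : gmodType G) (g : G) : {morph @gact G A g : a b / a - b}.
Proof.
move=> a b; apply: (addIr (gact g b)).
by rewrite -gactD !subrK.
Qed.

Lemma coboundaryB (A : gmodType G) j :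
  {morph @coboundary A j : f h / f - h}.
Proof.
move=> f h; apply/funext => g; rewrite /coboundary.
have subE (T : Type) (u v : T -> A) x : (u - v) x = u x - v x by [].
rewrite !subE; under eq_bigr do rewrite subE mulrzBl.
rewrite gactB mulrzBl sumrB.
by rewrite [X in X + _ = _]addrACA -opprD [LHS]addrACA -opprD.
Qed.

Lemma continuousB_gmod (T : topologicalType) (A : gmodType G) (f h : T -> A) :
  continuous f -> continuous h -> continuous (f - h).
Proof.
move=> cf ch x.
apply: (continuous_comp (f := fun t => (f t, h t)) (g := fun u : A * A => u.1 - u.2)).
  by apply: cvg_pair; [exact: cf|exact: ch].
exact: sub_continuous.
Qed.

(* A 0-coboundary is zero, there being no cochains in degree -1. *)
Definition is_coboundary (A : gmodType G) (j : nat) : (gpow G j -> A) -> Prop :=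
  match j with
  | 0 => fun f => f = 0
  | k.+1 => fun f => exists2 h : gpow G k -> A,
                       continuous h & coboundary h = f
  end.

Lemma is_coboundary0 (A : gmodType G) j : @is_coboundary A j 0.
Proof.
case: j => [//|k]; exists 0; first by move=> x; exact: cst_continuous.
by rewrite -(subrr 0) coboundaryB subrr.
Qed.

Lemma is_coboundaryB (A : gmodType G) j (f h : gpow G j -> A) :
  is_coboundary f -> is_coboundary h -> is_coboundary (f - h).
Proof.
case: j f h => [|k] f h /=; first by move=> -> ->; rewrite subrr.
move=> [f' cf' <-] [h' ch' <-]; exists (f' - h'); last exact: coboundaryB.
exact: continuousB_gmod.
Qed.

Section Def.
Variables (A : gmodType G) (j : nat).

Definition cocycle_pred : {pred gpow G j -> A} :=
  fun f => `[< continuous f /\ coboundary f = 0 >].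

Lemma cocycle_zmod_closed : zmod_closed cocycle_pred.
Proof.
split.
  apply/asboolP; split; first by move=> x; exact: cst_continuous.
  by rewrite -(subrr 0) coboundaryB subrr.
move=> f h /asboolP[cf df] /asboolP[ch dh]; apply/asboolP; split.
  exact: continuousB_gmod.
by rewrite coboundaryB df dh subrr.
Qed.

HB.instance Definition _ := GRing.isZmodClosed.Build _ cocycle_pred cocycle_zmod_closed.

Definition cocycle := {f : gpow G j -> A | f \in cocycle_pred}.
HB.instance Definition _ := SubChoice.on cocycle.
HB.instance Definition _ := [SubChoice_isSubZmodule of cocycle by <:].

(* All j-coboundaries are cocycles (d o d = 0), so this cuts out B^j in Z^j. *)
Definition coboundary_pred : {pred cocycle} :=
  fun z => `[< is_coboundary (val z) >].

Lemma coboundary_zmod_closed : zmod_closed coboundary_pred.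
Proof.
split; first by apply/asboolP; exact: is_coboundary0.
by move=> y z /asboolP By /asboolP Bz; apply/asboolP; exact: is_coboundaryB.
Qed.

HB.instance Definition _ :=
  GRing.isZmodClosed.Build _ coboundary_pred coboundary_zmod_closed.

Definition cohomology := Quotient.quot coboundary_pred.
HB.instance Definition _ := ZmodQuotient.on cohomology.

End Def.

Section Functoriality.
Variables (A B : gmodType G) (phi : gmodHom A B) (j : nat).

Lemma coboundary_comp k (f : gpow G k -> A) :
  coboundary (phi \o f) = phi \o coboundary f.
Proof.
apply/funext => g; rewrite /coboundary /= !raddfD /= gmodHom_act raddfMz.
rewrite raddf_sum; congr (_ + _ + _).
by apply: eq_bigr => l _; rewrite raddfMz.
Qed.

Lemma continuous_gmodHom_comp (T : topologicalType) (f : T -> A) :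
  continuous f -> continuous (phi \o f).
Proof.
by move=> cf x; apply: continuous_comp; [exact: cf|exact: gmodHom_continuous].
Qed.

Lemma is_coboundary_comp k (f : gpow G k -> A) :
  is_coboundary f -> is_coboundary (phi \o f).
Proof.
case: k f => [|k] f /=; first by move=> ->; apply/funext => x /=; exact: raddf0.
move=> [h ch <-]; exists (phi \o h); first exact: continuous_gmodHom_comp.
exact: coboundary_comp.
Qed.

Lemma cocycle_map_subproof (z : cocycle A j) :
  phi \o val z \in @cocycle_pred B j.
Proof.
have /asboolP[cz dz] := valP z; apply/asboolP; split.
  exact: continuous_gmodHom_comp.
by rewrite coboundary_comp dz; apply/funext => x /=; exact: raddf0.
Qed.

Definition cocycle_map (z : cocycle A j) : cocycle B j :=
  Sub (phi \o val z) (cocycle_map_subproof z).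

(* [\pi] is the projection of cocycles onto cohomology classes and [repr]
   picks a representative; see [cohomology_map_pi]. *)
Definition cohomology_map (x : cohomology A j) : cohomology B j :=
  \pi_(cohomology B j) (cocycle_map (repr x)).

Lemma cohomology_map_pi (z : cocycle A j) :
  cohomology_map (\pi_(cohomology A j) z) =
  \pi_(cohomology B j) (cocycle_map z).
Proof.
have : repr (\pi_(cohomology A j) z) = z %[mod cohomology A j] by exact: reprK.
rewrite /cohomology_map; move: (repr _) => y /eqP.
rewrite -Quotient.idealrBE => /asboolP Byz; apply/eqP.
rewrite -Quotient.idealrBE; apply/asboolP.
have -> : val (cocycle_map y - cocycle_map z) = phi \o val (y - z).
  by apply/funext => x /=; rewrite raddfB.
exact: is_coboundary_comp.
Qed.

Lemma cohomology_map_is_additive : zmod_morphism cohomology_map.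
Proof.
move=> x y; rewrite -[x]reprK -[y]reprK -raddfB !cohomology_map_pi -raddfB.
congr (\pi _); apply/val_inj/funext => g /=; exact: raddfB.
Qed.

HB.instance Definition _ := GRing.isZmodMorphism.Build _ _ cohomology_map
  cohomology_map_is_additive.

End Functoriality.
End Cohomology.

(** * The first derived limit *)

Section Lim1.

Definition countable_product (X : nat -> zmodType) := forall n, X n.

Section Product.
Variable X : nat -> zmodType.
Local Notation P := (countable_product X).
Implicit Types x y : P.

HB.instance Definition _ := Choice.copy P (forall n, X n).

Let zero : P := fun=> 0.
Let opp x : P := fun n => - x n.
Let add x y : P := fun n => x n + y n.

Let addA : associative add.
Proof. by move=> x y z; apply: functional_extensionality_dep => n; exact: addrA. Qed.
Let addC : commutative add.
Proof. by move=> x y; apply: functional_extensionality_dep => n; exact: addrC. Qed.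
Let add0 : left_id zero add.
Proof. by move=> x; apply: functional_extensionality_dep => n; exact: add0r. Qed.
Let addN : left_inverse zero opp add.
Proof. by move=> x; apply: functional_extensionality_dep => n; exact: addNr. Qed.

HB.instance Definition _ := GRing.isZmodule.Build P addA addC add0 addN.

End Product.

Variables (X : nat -> zmodType) (phi : forall n, {additive X n.+1 -> X n}).

Definition one_sub_shift (x : countable_product X) : countable_product X :=
  fun n => x n - phi n (x n.+1).

Lemma one_sub_shift_is_additive : zmod_morphism one_sub_shift.
Proof.
move=> x y; apply: functional_extensionality_dep => n.
rewrite /one_sub_shift -[RHS]/(_ - _) -[(x - y) n]/(x n - y n).
by rewrite -[(x - y) n.+1]/(x n.+1 - y n.+1) raddfB opprD addrACA -opprD.
Qed.

HB.instance Definition _ := GRing.isZmodMorphism.Build _ _ one_sub_shift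
  one_sub_shift_is_additive.

Definition one_sub_shift_image : {pred countable_product X} :=
  fun y => `[< exists x, one_sub_shift x = y >].

Lemma one_sub_shift_image_zmod_closed : zmod_closed one_sub_shift_image.
Proof.
split; first by apply/asboolP; exists 0; exact: raddf0.
move=> _ _ /asboolP[x <-] /asboolP[y <-]; apply/asboolP; exists (x - y).
exact: raddfB.
Qed.

HB.instance Definition _ :=
  GRing.isZmodClosed.Build _ one_sub_shift_image one_sub_shift_image_zmod_closed.

Definition lim1 := Quotient.quot one_sub_shift_image.
HB.instance Definition _ := ZmodQuotient.on lim1.

End Lim1.

(* Main.v *)
Require Import Defs.
From HB Require Import structures.
From mathcomp Require Import all_boot all_order all_algebra.
From mathcomp Require Import finmap.
From mathcomp Require Import all_classical all_reals all_analysis.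

(** Everything reduces to a finiteness statement: there are only finitely many
    continuous maps from $G^{i-1}$ to $A_n$.  For $i=1$ this holds because $G^0$
    is a point.  For $i>1$, since $A_n$ is finite and discrete, even continuity
    gives each point of $G^{i-1}$ a neighbourhood on which every continuous map
    to $A_n$ is constant; finitely many of these neighbourhoods cover the
    compact space $G^{i-1}$, so a continuous map is determined by its values at
    finitely many points ([evenly_continuous_finite]).  Hence there are finitely
    many cocycles, and $H^{i-1}(G,A_n)$ is finite ([finite_cohomology]).

    The derived limit of an inverse system of finite groups vanishes by
    compactness ([lim1_finite]): to solve $x_n - \phi_n(x_{n+1}) = y_n$ for all
    $n$, note that any finite number of these equations can be solved from the
    last one backwards, and use a König argument to choose the $x_n$ one by
    one so that each choice extends to solutions of arbitrary length. *)

Set Implicit Arguments.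
Unset Strict Implicit.
Unset Printing Implicit Defensive.

Import GRing.Theory.
Local Open Scope classical_set_scope.
Local Open Scope ring_scope.

(** * Finiteness of spaces of continuous maps *)

(** By induction on the list of points, prescribing one value at a time. *)
Lemma finite_determined_by_values (B : eqType) (A : Type) (F : set (B -> A))
    (s : seq B) :
  finite_set [set: A] ->
  (forall f h, F f -> F h -> {in s, f =1 h} -> f = h) ->
  finite_set F.
Proof.
move=> finA; elim: s F => [|b s IH] F Fdet.
  have [->|/set0P[f Ff]] := eqVneq F set0; first exact: finite_set0.
  apply: (@sub_finite_set _ _ [set f]); last exact: finite_set1.
  by move=> h Fh; apply: Fdet.
(* F is the union over a of its subsets of maps with value a at b. *)
rewrite (_ : F = \bigcup_(a in [set: A]) (F `&` [set f | f b = a])); last first.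
  apply/seteqP; split=> [f Ff|f [a _ []//]]; by exists (f b).
apply: bigcup_finite => // a _; apply: IH => f h [Ff fb] [Fh hb] fh.
apply: Fdet => // c; rewrite inE => /predU1P[->|]; last exact: fh.
by rewrite fb hb.
Qed.

(** Even continuity at b, applied to each open singleton {a}, yields a
    neighbourhood of b on which the maps sending b to a are constant; as A is
    finite, these neighbourhoods can be intersected over all a. *)
Lemma evenly_continuous_locally_constant (B A : topologicalType)
    (F : set (B -> A)) :
  finite_discrete A -> evenly_continuous F ->
  forall b, exists V : set B,
    nbhs b V /\ forall f c, F f -> V c -> f c = f b.
Proof.
move=> [finA openA] evF b.
have /choice[V_ V_P] a : exists V, nbhs b V /\
    forall f, F f -> f b = a -> f @` V `<=` [set a].
  have [|V [W [bV aW VW]]] := evF b a [set a].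
    by apply: open_nbhs_nbhs; split; [exact: openA|].
  exists V; split=> // f Ff fba; apply: VW => //.
  by rewrite fba; exact: nbhs_singleton.
have [s sE] := (finite_fsetP.1 finA).
exists (\bigcap_(a in [set` s]) (V_ a)); split.
  by apply: filter_bigI => a _; case: (V_P a).
move=> f c Ff cV.
have [_ V_cst] := V_P (f b); apply: (V_cst f) => //.
by exists c => //; apply: cV; rewrite -sE.
Qed.

Lemma compact_finite_nbhs_cover (B : topologicalType) (V_ : B -> set B) :
  compact [set: B] -> (forall b, nbhs b (V_ b)) ->
  exists s : seq B, forall c, exists2 b, b \in s & V_ b c.
Proof.
move=> cB bV; have [[b0 _]|B0] := pselect ([set: B] !=set0); last first.
  by exists [::] => c; case: B0; exists c.
(* The cover form of compactness is stated for pointed spaces. *)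
pose pB : ptopologicalType := HB.pack B (isPointed.Build B b0).
have : @compact pB [set: B] by exact: cB.
rewrite compact_cover => /(_ B setT (fun b => (V_ b)°)) [].
- by move=> b _; exact: open_interior.
- by move=> b _; exists b => //; exact: bV.
move=> D _ covD; exists D => c.
by have [b Db /interior_subset cV] := covD c I; exists b.
Qed.

Lemma evenly_continuous_finite (B A : topologicalType) (F : set (B -> A)) :
  compact [set: B] -> finite_discrete A -> evenly_continuous F ->
  finite_set F.
Proof.
move=> cB dA /(evenly_continuous_locally_constant dA)/choice[V_ V_P].
have [s covs] := compact_finite_nbhs_cover cB (fun b => (V_P b).1).
apply: (@finite_determined_by_values _ _ _ s dA.1) => f h Ff Fh fh.
apply/funext => c; have [b bs cV] := covs c.
have [_ V_cst] := V_P b.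
by rewrite (V_cst f c) // (V_cst h c) //; exact: fh.
Qed.

Lemma finite_continuous_gpow (G A : topologicalType) (m : nat) :
  compact [set: G] -> finite_discrete A -> evenly_continuous_wrt_pow A G m ->
  finite_set [set f : gpow G m -> A | continuous f].
Proof.
move=> cG dA; case: m => [_|m]; last first.
  apply: evenly_continuous_finite => //.
  have := @tychonoff 'I_m.+1 (fun=> G) (fun=> setT) (fun=> cG).
  by congr compact; apply/seteqP; split.
(* $G^0$ is a point. *)
have pt (g h : gpow G 0) : g = h by apply/funext; case.
have g0 : gpow G 0 by case.
apply: (@finite_determined_by_values _ _ _ [:: g0] dA.1) => f h _ _ fh.
by apply/funext => g; rewrite (pt g g0); apply: fh; rewrite inE.
Qed.

(** * Finiteness of cohomology *)

Lemma finite_cohomology (G : topologicalGroupType) (A : gmodType G) (m : nat) :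
  compact [set: G] -> finite_discrete A -> evenly_continuous_wrt_pow A G m ->
  finite_set [set: cohomology A m].
Proof.
move=> cG dA evA.
have finZ : finite_set [set: cocycle A m].
  rewrite (_ : setT = val @^-1` [set f : gpow G m -> A | continuous f]).
    apply: finite_preimage; last exact: finite_continuous_gpow.
    by move=> y z _ _; exact: val_inj.
  by apply/esym/seteqP; split=> // z _; have /asboolP[] := valP z.
rewrite (_ : setT = \pi_(cohomology A m)%qT @` [set: cocycle A m]).
  exact: finite_image.
by apply/esym/seteqP; split=> // x _; exists (repr x) => //; exact: reprK.
Qed.

(** * The derived limit of finite groups *)

(** If each point x leaves the sequence at some step k(x), then the set at step
    max k(x) is empty. *)
Lemma decreasing_finite_bigcap (X : choiceType) (T : nat -> set X) :
  finite_set [set: X] -> (forall k, T k !=set0) ->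
  (forall k, T k.+1 `<=` T k) -> exists x, forall k, T k x.
Proof.
move=> /finite_seqP[s sE] T0 Tdec; apply: contrapT => noT.
have {}noT x : exists k, ~ T k x.
  by apply/not_existsP => allT; apply: noT; exists x => k; apply: contrapT.
have [k_ kP] := choice noT.
have Tle m n : (m <= n)%N -> T n `<=` T m.
  move=> mn; rewrite -(subnK mn); elim: (n - m)%N => // d IH x.
  by rewrite addSn => /Tdec/IH.
have [x Tx] := T0 (\max_(x <- s) k_ x); apply: (kP x).
apply: Tle Tx; apply: (@leq_bigmax_seq _ s predT k_ x) => //.
by have : [set` s] x by rewrite -sE.
Qed.

Section Lim1Finite.
Variables (X : nat -> zmodType) (phi : forall n, {additive X n.+1 -> X n}).
Variable y : countable_product X.

(** The values at $n$ of the families that solve the equations with indices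
    $n, \dots, n+k-1$. *)
Fixpoint partial_solutions (k n : nat) : set (X n) :=
  if k is k'.+1 then [set y n + phi n z | z in @partial_solutions k' n.+1]
  else setT.
Arguments partial_solutions : clear implicits.

Lemma partial_solutions_nonempty k n : partial_solutions k n !=set0.
Proof.
elim: k n => [|k IH] n; first by exists 0.
by have [z kz] := IH n.+1; exists (y n + phi n z); exists z.
Qed.

Lemma partial_solutions_decreasing k n :
  partial_solutions k.+1 n `<=` partial_solutions k n.
Proof.
elim: k n => [//|k IH] n _ [z kz <-].
by exists z => //; exact: IH.
Qed.

Hypothesis finX : forall n, finite_set [set: X n].

Lemma extendable_exists : exists x, forall k, partial_solutions k 0%N x.
Proof.
apply: (decreasing_finite_bigcap (finX 0%N)) => k.
  exact: partial_solutions_nonempty.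
exact: partial_solutions_decreasing.
Qed.

(** König step: the fibre of extensions of x meets every set of partial
    solutions at n+1, hence, by finiteness, all of them at once. *)
Lemma extendable_step n (x : X n) : (forall k, partial_solutions k n x) ->
  exists z, x = y n + phi n z /\ forall k, partial_solutions k n.+1 z.
Proof.
move=> extx.
have [k|k z [xE kz]|z zP] := @decreasing_finite_bigcap _
  (fun k => [set z | x = y n + phi n z /\ partial_solutions k n.+1 z])
  (finX n.+1).
- by have [z kz xE] := extx k.+1; exists z.
- by split=> //; exact: partial_solutions_decreasing.
by exists z; split=> [|k]; [case: (zP 0%N)|case: (zP k)].
Qed.

Lemma one_sub_shift_surjective : exists x, one_sub_shift phi x = y.
Proof.
pose E n := {x : X n | forall k, partial_solutions k n x}.
have [e0 e0P] := extendable_exists.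
have step n (e : E n) :
    {z : E n.+1 | sval e = y n + phi n (sval z)}.
  by have /cid[z [eE zP]] := extendable_step (svalP e); exists (exist _ z zP).
pose e := nat_rect E (exist _ e0 e0P) (fun n en => sval (step n en)).
exists (fun n => sval (e n)); apply: functional_extensionality_dep => n.
by rewrite /one_sub_shift {1}(svalP (step n (e n))) addrK.
Qed.

End Lim1Finite.

Lemma lim1_finite (X : nat -> zmodType)
    (phi : forall n, {additive X n.+1 -> X n}) :
  (forall n, finite_set [set: X n]) -> forall x : lim1 phi, x = 0.
Proof.
move=> finX x; rewrite -[x]reprK; apply/eqP.
rewrite -(raddf0 (\pi_(lim1 phi)%qT)) -Quotient.idealrBE subr0.
by apply/asboolP; exact: one_sub_shift_surjective.
Qed.

Theorem mainTheorem3 (G : topologicalGroupType) (i : nat)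
    (A : gmodType G) (A_ : nat -> gmodType G)
    (phi : forall n, gmodHom (A_ n.+1) (A_ n))
    (p : forall n, gmodHom A (A_ n)) :
  profinite G ->
  (1 <= i)%N ->
  compact [set: A] ->
  (forall n, finite_discrete (A_ n)) ->
  is_inverse_limit phi p ->
  (forall n, evenly_continuous_wrt_pow (A_ n) G i.-1) ->
  forall x : @lim1 (fun n => cohomology (A_ n) i.-1)
                   (fun n => cohomology_map (phi n) (j := i.-1)), x = 0.
Proof.
move=> [cG _ _] _ _ dA _ evA; apply: lim1_finite => n.
exact: finite_cohomology.
Qed.
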